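(* (Unique Extension Theorem) Let $q,d,w\ge1$ be integers, let $\Gamma(q,d,w)\in\Omega_H(q,d,w)$, and let $\Gamma(q,d+1,w)\in\Omega_H(q,d+1,w)$ be a maximally $\Sigma_H$-consistent extension of $\Gamma(q,d,w)$. Let $\gamma^{=0}\wedge\gamma^{>0}$ be the statement of the atom $\Gamma(q,d,w)$, with propositional part $\gamma^{=0}$ and probability part $\gamma^{>0}$, and put $\Gamma(q,1,w):=\Gamma(q,d,w)\cap\mathcal{L}(q,1,w)$. Let $\phi$ be a formula in $\mathcal{L}(q,d,w)$ whose normal form is the disjunction of the statements $\phi_1^{=0}\wedge\phi_1^{>0},\ \dots,\ \phi_n^{=0}\wedge\phi_n^{>0}$, and suppose that, for some $m\le n$, up to logical equivalence $\phi_i^{>0}=\gamma^{>0}$ for $1\le i\le m$ and $\phi_j^{>0}\ne\gamma^{>0}$ for $m+1\le j\le n$. Then $$\alpha_{\phi}^{\Gamma(q,d+1,w)}=\alpha_{\bigvee_{i=1}^m\phi_i^{=0}}^{\Gamma(q,1,w)}\quad\text{and}\quad \beta_{\phi}^{\Gamma(q,d+1,w)}=\beta_{\bigvee_{i=1}^m\phi_i^{=0}}^{\Gamma(q,1,w)}.$$ That is to say, $\Gamma(q,d,w)$ has one and only one maximally $\Sigma_H$-consistent extension in $\Omega_H(q,d+1,w)$, namely $\Gamma(q,d+1,w)$.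
   Context: Language $\mathcal{L}$: formulas are given by $\phi ::= p \mid \neg\phi \mid \phi_1\wedge\phi_2 \mid L_r\phi$, with $p$ from a countable list $p_1,p_2,\dots$ of propositional letters and $r\in\mathbb{Q}\cap[0,1]$; $M_r\phi$ abbreviates $L_{1-r}\neg\phi$. Depth: $dp(p)=0$, $dp(\neg\phi)=dp(\phi)$, $dp(\phi_1\wedge\phi_2)=\max\{dp(\phi_1),dp(\phi_2)\}$, $dp(L_r\phi)=dp(\phi)+1$. A logic is a set of formulas containing all propositional tautologies and closed under modus ponens and uniform substitution. $\Sigma_H$ is the smallest logic containing (A1) $L_0\phi$; (A2) $L_r\top$; (A3) $L_r(\phi\wedge\psi)\wedge L_t(\phi\wedge\neg\psi)\to L_{r+t}\phi$ for $r+t\le 1$; (A4) $\neg L_r(\phi\wedge\psi)\wedge\neg L_s(\phi\wedge\neg\psi)\to\neg L_{r+s}\phi$ for $r+s\le1$; (A5) $L_r\phi\to\neg L_s\neg\phi$ for $r+s>1$; $(4_p)$ $L_r\phi\to L_1L_r\phi$; $(5_p)$ $\neg L_r\phi\to L_1\neg L_r\phi$; and closed under (DIS): from $\phi\leftrightarrow\psi$ infer $L_r\phi\leftrightarrow L_r\psi$; and (ARCH): if $\gamma\to L_s\phi$ is a theorem for all $s<r$, then $\gamma\to L_r\phi$ is a theorem. A finite set of formulas is $\Sigma_H$-consistent if the negation of its conjunction is not in $\Sigma_H$; an arbitrary set is consistent if all its finite subsets are. $\mathcal{L}(q,d,w)$ is the set of formulas in the letters $p_1,\dots,p_w$, with all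 indices multiples of $1/q$ in $[0,1]$, of depth $\le d$, with logically (provably) equivalent formulas identified (one works with representatives); it is a finite set. $\Omega_H(q,d,w)$ is the set of maximally $\Sigma_H$-consistent sets of formulas in $\mathcal{L}(q,d,w)$; its elements are called atoms. For an atom $\Phi$, the formula $\bigwedge\{p_i:p_i\in\Phi\}\wedge\bigwedge\{\neg p_i:\neg p_i\in\Phi\}\wedge\bigwedge\{L_r\chi:L_r\chi\in\Phi\}\wedge\bigwedge\{\neg L_r\chi:\neg L_r\chi\in\Phi\}$ is the statement of the atom $\Phi$ (equivalent to the conjunction of $\Phi$); the conjunction of the first two groups is its propositional part (superscript $=0$), and the conjunction of the last two groups is its probability part (superscript $>0$). Every formula in $\mathcal{L}(q,d,w)$ is equivalent to a disjunction of statements in $\mathcal{L}(q,d,w)$, called its normal form; an empty disjunction is $\bot$. For an atom $\Xi\in\Omega_H(q,d',w)$ with $d'\ge1$ and $\phi\in\mathcal{L}(q,d'-1,w)$: $\alpha_\phi^\Xi=\max\{r: L_r\phi\in\Xi\}$ and $\beta_\phi^\Xi=\min\{r: M_r\phi\in\Xi\}$, with $r$ ranging over multiples of $1/q$ in $[0,1]$. *)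

(* Defs.v *)
From HB Require Import structures.
From mathcomp Require Import all_boot all_order all_algebra.
From mathcomp Require Import boolp classical_sets.

Set Implicit Arguments.
Unset Strict Implicit.
Unset Printing Implicit Defensive.

Import Order.TTheory GRing.Theory Num.Theory.
Local Open Scope ring_scope.
Local Open Scope quotient_scope.
Local Open Scope classical_set_scope.

Definition idx := {r : rat | 0 <= r <= 1}.

Fact onem_idx_proof (r : idx) : 0 <= 1 - val r <= 1.
Proof. by case: r => r /= /andP[r0 r1]; rewrite subr_ge0 r1 gerBl r0. Qed.

Definition onem_idx (r : idx) : idx :=
  exist (fun x : rat => 0 <= x <= 1) (1 - val r) (onem_idx_proof r).

Fact grid_proof (q : nat) (k : 'I_q.+1) : 0 <= (k%:R / q%:R : rat) <= 1.
Proof.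
case: q k => [|q] k; first by rewrite invr0 mulr0 lexx ler01.
by rewrite divr_ge0 ?ler0n //= ler_pdivrMr ?ltr0n // mul1r ler_nat -ltnS.
Qed.

(* The k-th multiple of 1/q in [0, 1]. *)
Definition grid (q : nat) (k : 'I_q.+1) : idx :=
  exist (fun x : rat => 0 <= x <= 1) (k%:R / q%:R) (grid_proof k).

(* [Var i] is the letter p_{i+1}. *)
Inductive fml : Type :=
  | Var of nat
  | Neg of fml
  | And of fml & fml
  | Lop of idx & fml.

HB.instance Definition _ := gen_eqMixin fml.
HB.instance Definition _ := gen_choiceMixin fml.

Definition Or (f g : fml) : fml := Neg (And (Neg f) (Neg g)).
Definition Imp (f g : fml) : fml := Neg (And f (Neg g)).
Definition Iff (f g : fml) : fml := And (Imp f g) (Imp g f).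
Definition Bot : fml := And (Var 0) (Neg (Var 0)).
Definition Top : fml := Neg Bot.
Definition Mop (r : idx) (f : fml) : fml := Lop (onem_idx r) (Neg f).

Definition bigAnd (s : seq fml) : fml := \big[And/Top]_(f <- s) f.

Fixpoint dp (f : fml) : nat :=
  match f with
  | Var _ => 0
  | Neg f1 => dp f1
  | And f1 f2 => maxn (dp f1) (dp f2)
  | Lop _ f1 => (dp f1).+1
  end.

Fixpoint subst (sigma : nat -> fml) (f : fml) : fml :=
  match f with
  | Var i => sigma i
  | Neg f1 => Neg (subst sigma f1)
  | And f1 f2 => And (subst sigma f1) (subst sigma f2)
  | Lop r f1 => Lop r (subst sigma f1)
  end.

(* Formulas L_r f count as propositional atoms, so [tautology] consists of all
   instances of propositional tautologies in the modal language. *)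
Fixpoint peval (v : fml -> bool) (f : fml) : bool :=
  match f with
  | Var _ | Lop _ _ => v f
  | Neg f1 => ~~ peval v f1
  | And f1 f2 => peval v f1 && peval v f2
  end.

Definition tautology (f : fml) : Prop := forall v, peval v f.

(* The logic Sigma_H. In H_A3 and H_A4 the index u is the sum of the two others,
   so that u : idx encodes the side condition that this sum is at most 1. *)
Inductive SigmaH : fml -> Prop :=
  | H_taut f : tautology f -> SigmaH f
  | H_mp f g : SigmaH (Imp f g) -> SigmaH f -> SigmaH g
  | H_subst sigma f : SigmaH f -> SigmaH (subst sigma f)
  | H_A1 (r : idx) f : val r = 0 -> SigmaH (Lop r f)
  | H_A2 r : SigmaH (Lop r Top)
  | H_A3 (r t u : idx) f g : val u = val r + val t ->
      SigmaH (Imp (And (Lop r (And f g)) (Lop t (And f (Neg g)))) (Lop u f))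
  | H_A4 (r s u : idx) f g : val u = val r + val s ->
      SigmaH (Imp (And (Neg (Lop r (And f g))) (Neg (Lop s (And f (Neg g)))))
                  (Neg (Lop u f)))
  | H_A5 (r s : idx) f : 1 < val r + val s ->
      SigmaH (Imp (Lop r f) (Neg (Lop s (Neg f))))
  | H_4p (r i1 : idx) f : val i1 = 1 ->
      SigmaH (Imp (Lop r f) (Lop i1 (Lop r f)))
  | H_5p (r i1 : idx) f : val i1 = 1 ->
      SigmaH (Imp (Neg (Lop r f)) (Lop i1 (Neg (Lop r f))))
  | H_DIS r f g : SigmaH (Iff f g) -> SigmaH (Iff (Lop r f) (Lop r g))
  | H_ARCH (r : idx) g f :
      (forall s : idx, val s < val r -> SigmaH (Imp g (Lop s f))) ->
      SigmaH (Imp g (Lop r f)).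

Definition consistent (X : set fml) : Prop :=
  forall s : seq fml, [set` s] `<=` X -> ~ SigmaH (Neg (bigAnd s)).

Definition prov_eq (f g : fml) : bool := `[< SigmaH (Iff f g) >].

Fact prov_eq_refl : reflexive prov_eq.
Proof.
by move=> f; apply/asboolP/H_taut => v /=; case: (peval v f).
Qed.

Fact prov_eq_sym : symmetric prov_eq.
Proof.
suff sub f g : SigmaH (Iff f g) -> SigmaH (Iff g f).
  by move=> f g; apply: asbool_equiv_eq; split; apply: sub.
apply: H_mp; apply: H_taut => v /=.
by case: (peval v f); case: (peval v g).
Qed.

Fact prov_eq_trans : transitive prov_eq.
Proof.
move=> g f h /asboolP fg /asboolP gh; apply/asboolP.
apply: H_mp gh; apply: H_mp fg; apply: H_taut => v /=.
by case: (peval v f); case: (peval v g); case: (peval v h).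
Qed.

Canonical prov_equiv := EquivRel prov_eq prov_eq_refl prov_eq_sym prov_eq_trans.

(* Formulas modulo provable equivalence. *)
Definition lfml : Type := {eq_quot prov_equiv}.
Definition cls (f : fml) : lfml := \pi_{eq_quot prov_equiv} f.

Fixpoint letters_lt (w : nat) (f : fml) : Prop :=
  match f with
  | Var i => (i < w)%N
  | Neg f1 => letters_lt w f1
  | And f1 f2 => letters_lt w f1 /\ letters_lt w f2
  | Lop _ f1 => letters_lt w f1
  end.

Fixpoint accuracy (q : nat) (f : fml) : Prop :=
  match f with
  | Var _ => True
  | Neg f1 => accuracy q f1
  | And f1 f2 => accuracy q f1 /\ accuracy q f2
  | Lop r f1 => (exists k : 'I_q.+1, r = grid k) /\ accuracy q f1
  end.

(* The representatives of the elements of L(q,d,w), and L(q,d,w) itself. *)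
Definition lang_fml (q d w : nat) : set fml :=
  [set f | [/\ letters_lt w f, accuracy q f & (dp f <= d)%N]].

Definition lang (q d w : nat) : set lfml := cls @` lang_fml q d w.

Definition OmegaH (q d w : nat) : set (set lfml) :=
  [set Phi | [/\ Phi `<=` lang q d w,
                 consistent (cls @^-1` Phi) &
                 forall Psi : set lfml, Psi `<=` lang q d w ->
                   consistent (cls @^-1` Psi) -> Phi `<=` Psi -> Psi = Phi]].

(* g is a conjunction of the formulas in A, equivalent formulas being
   identified: the conjuncts are members of A representing every class met
   by A. Neither the choice nor the order of the representatives is fixed. *)
Definition conj_of (A : set fml) (g : fml) : Prop :=
  exists s : seq fml,
    [/\ [set` s] `<=` A, cls @` A `<=` cls @` [set` s] & g = bigAnd s].

Definition prop_part (q d w : nat) (Phi : set lfml) (g : fml) : Prop :=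
  exists g1 g2 : fml,
    [/\ conj_of [set f | [/\ lang_fml q d w f, Phi (cls f) &
                             exists i, f = Var i]] g1,
        conj_of [set f | [/\ lang_fml q d w f, Phi (cls f) &
                             exists i, f = Neg (Var i)]] g2 &
        g = And g1 g2].

Definition prob_part (q d w : nat) (Phi : set lfml) (g : fml) : Prop :=
  exists g1 g2 : fml,
    [/\ conj_of [set f | [/\ lang_fml q d w f, Phi (cls f) &
                             exists r chi, f = Lop r chi]] g1,
        conj_of [set f | [/\ lang_fml q d w f, Phi (cls f) &
                             exists r chi, f = Neg (Lop r chi)]] g2 &
        g = And g1 g2].

(* And g0 gp is a statement of Phi, with propositional part g0 and probability
   part gp. *)
Definition is_statement (q d w : nat) (Phi : set lfml) (g0 gp : fml) : Prop :=
  prop_part q d w Phi g0 /\ prob_part q d w Phi gp.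

(* The defaults ord0 and ord_max are harmless: if Xi is an atom of depth d + 1
   and f is in L(q,d,w), then L_0 f and M_1 f (which is L_0 of Neg f) are in Xi
   by H_A1, so that the maximum and the minimum range over nonempty sets. *)
Definition alpha (q : nat) (Xi : set lfml) (f : fml) : rat :=
  val (grid [arg max_(k > (ord0 : 'I_q.+1) | `[< Xi (cls (Lop (grid k) f)) >])
               (k : nat)]%N).

Definition beta (q : nat) (Xi : set lfml) (f : fml) : rat :=
  val (grid [arg min_(k < (ord_max : 'I_q.+1) | `[< Xi (cls (Mop (grid k) f)) >])
               (k : nat)]%N).

(* Main.v *)
Require Import Defs.
From mathcomp Require Import all_boot all_order all_algebra.
From mathcomp Require Import boolp classical_sets.

(** An atom of depth at least 1 already knows all its own probabilities. By the
    axioms 4p and 5p every modal literal, [L_r f] or its negation, implies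
    its own certainty, and certainty is closed under conjunction; hence so does
    the conjunction [g] of finitely many modal literals of the atom. If [g]
    also implies that [f] and [h] are equivalent, then under [g] this
    equivalence is certain, and therefore [f] and [h] have the same
    probabilities: [g] implies [L_r f <-> L_r h] for every [r]
    ([Lop_congr_introspective]). This is where the additivity axioms and the
    rule ARCH enter, in [Lop_And_certain].

    For the formulas for alpha and beta, take for [g] the probability part of
    the atom. A probability part decides every modal formula of the language, so
    two of them are either equivalent or contradictory ([prob_part_dichotomy]).
    Under [g] the normal form of [f] therefore collapses to the disjunction [h]
    of the propositional parts of those disjuncts whose probability part is
    [g]. So [L_r f] belongs to the extension exactly when [L_r h] does; and
    [L_r h], having depth 1, was decided by the atom.

    For uniqueness it has to be shown that [L_r f], with [f] of depth at most
    [d], is decided by the atom alone. Normal forms, and with them the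
    finiteness of the language up to equivalence, can be avoided: replacing each
    outermost modal subformula of [f] by its truth value in the atom gives a
    propositional [h] which is equivalent to [f] under the conjunction of the
    finitely many modal literals used ([atom_flatten]). *)

Set Implicit Arguments.
Unset Strict Implicit.
Unset Printing Implicit Defensive.

Import Order.TTheory GRing.Theory Num.Theory.
Local Open Scope ring_scope.
Local Open Scope quotient_scope.
Local Open Scope classical_set_scope.

(** * Propositional reasoning *)

Lemma peval_bigAnd v s : peval v (bigAnd s) = all (peval v) s.
Proof.
rewrite /bigAnd; elim: s => [|f s IHs]; first by rewrite big_nil /= andbN.
by rewrite big_cons /= IHs.
Qed.

Lemma peval_bigOr v (I : Type) (r : seq I) (P : pred I) (F : I -> fml) :
  peval v (\big[Or/Bot]_(i <- r | P i) F i)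
    = has (fun i => P i && peval v (F i)) r.
Proof.
elim: r => [|i r IHr]; first by rewrite big_nil /= andbN.
by rewrite big_cons /=; case: (P i); rewrite /= IHr // negb_and !negbK.
Qed.

Lemma SigmaH_conseq (ps : seq fml) f :
  {in ps, forall p, SigmaH p} ->
  (forall v, all (peval v) ps -> peval v f) -> SigmaH f.
Proof.
elim: ps f => [|p ps IHps] f psH psf.
  by apply: H_taut => v; apply: psf.
have pH : SigmaH p by apply: psH; rewrite mem_head.
apply: H_mp pH; apply: IHps => [p' p'ps|v psv /=].
  by apply: psH; rewrite in_cons p'ps orbT.
by apply/negP => /andP[pv /negP]; apply; apply: psf; rewrite /= pv.
Qed.

Lemma SigmaH_conseq1 p f :
  SigmaH p -> (forall v, peval v p -> peval v f) -> SigmaH f.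
Proof.
move=> pH pf; apply: (@SigmaH_conseq [:: p]) => [p'|v].
  by rewrite inE => /eqP->.
by rewrite /= andbT; apply: pf.
Qed.

Lemma SigmaH_conseq2 p1 p2 f :
  SigmaH p1 -> SigmaH p2 ->
  (forall v, peval v p1 -> peval v p2 -> peval v f) -> SigmaH f.
Proof.
move=> p1H p2H pf; apply: (@SigmaH_conseq [:: p1; p2]) => [p'|v].
  by rewrite !inE => /orP[] /eqP->.
by rewrite /= andbT => /andP[]; apply: pf.
Qed.

Lemma SigmaH_conseq3 p1 p2 p3 f :
  SigmaH p1 -> SigmaH p2 -> SigmaH p3 ->
  (forall v, peval v p1 -> peval v p2 -> peval v p3 -> peval v f) -> SigmaH f.
Proof.
move=> p1H p2H p3H pf; apply: (@SigmaH_conseq [:: p1; p2; p3]) => [p'|v].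
  by rewrite !inE => /or3P[] /eqP->.
by rewrite /= andbT => /and3P[]; apply: pf.
Qed.

Lemma Imp_trans g f h : SigmaH (Imp f g) -> SigmaH (Imp g h) -> SigmaH (Imp f h).
Proof.
move=> fg gh; apply: SigmaH_conseq2 fg gh _ => v /=.
by case: (peval v f); case: (peval v g).
Qed.

Lemma bigAnd_intro s g :
  (forall f, f \in s -> SigmaH (Imp g f)) -> SigmaH (Imp g (bigAnd s)).
Proof.
move=> gs; apply: (@SigmaH_conseq [seq Imp g f | f <- s]) => [p /mapP[f fs ->]|v].
  exact: gs.
rewrite all_map /= peval_bigAnd => /allP gsv; apply/negP => /andP[gv /negP].
by apply; apply/allP => f /gsv /=; rewrite gv negbK.
Qed.

Lemma bigAnd_elim s f : f \in s -> SigmaH (Imp (bigAnd s) f).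
Proof.
move=> fs; apply: H_taut => v /=; rewrite peval_bigAnd.
by apply/negP => /andP[/allP/(_ _ fs) ->].
Qed.

(** * Probability operators and certainty *)

Definition idx0 : idx := exist (fun x : rat => 0 <= x <= 1) 0 isT.
Definition idx1 : idx := exist (fun x : rat => 0 <= x <= 1) 1 isT.

Lemma Lop_mono r f g : SigmaH (Imp f g) -> SigmaH (Imp (Lop r f) (Lop r g)).
Proof.
move=> fg.
have gf : SigmaH (Iff f (And g f)).
  apply: SigmaH_conseq1 fg _ => v /=.
  by case: (peval v f); case: (peval v g).
(* [g] splits into [f], of probability at least [r], and [g /\ ~ f]. *)
have A3 : SigmaH (Imp (And (Lop r (And g f)) (Lop idx0 (And g (Neg f))))
                      (Lop r g)) by apply: H_A3; rewrite addr0.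
have A1 : SigmaH (Lop idx0 (And g (Neg f))) by apply: H_A1.
apply: SigmaH_conseq3 (H_DIS r gf) A3 A1 _ => v /=.
by do 4!case: (v _).
Qed.

(** If [g] is certain then, by A5, [f /\ ~ g] has probability at least [e] for no
    positive [e]; by A4, [f /\ g] then has probability at least [s] for every
    [s] below the bound [t] for [f]. ARCH closes the gap between [s] and [t]. *)
Lemma Lop_And_certain t f g :
  SigmaH (Imp (And (Lop idx1 g) (Lop t f)) (Lop t (And f g))).
Proof.
apply: H_ARCH => s lt_st.
have e01 : 0 <= val t - val s <= 1.
  case: s t lt_st => [s /= /andP[s0 _]] [t /= /andP[_ t1]] /ltW st.
  by rewrite subr_ge0 st lerBlDr (le_trans t1) // lerDl.
pose e : idx := exist (fun x : rat => 0 <= x <= 1) (val t - val s) e01.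
have A4 : SigmaH (Imp (And (Neg (Lop s (And f g))) (Neg (Lop e (And f (Neg g)))))
                      (Neg (Lop t f))) by apply: H_A4; rewrite /= addrC subrK.
have A5 : SigmaH (Imp (Lop idx1 g) (Neg (Lop e (Neg g)))).
  by apply: H_A5; rewrite /= ltrDl subr_gt0.
have mono : SigmaH (Imp (Lop e (And f (Neg g))) (Lop e (Neg g))).
  apply: Lop_mono; apply: H_taut => v /=.
  by case: (peval v f); case: (peval v g).
apply: SigmaH_conseq3 A4 A5 mono _ => v /=.
by do 5!case: (v _).
Qed.

Definition introspective (g : fml) : Prop := SigmaH (Imp g (Lop idx1 g)).

Lemma introspective_And f g :
  introspective f -> introspective g -> introspective (And f g).
Proof.
move=> fI gI; apply: SigmaH_conseq3 fI gI (Lop_And_certain idx1 f g) _ => v /=.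
by case: (peval v f); case: (peval v g); do 3!case: (v _).
Qed.

Lemma introspective_bigAnd s :
  {in s, forall f, introspective f} -> introspective (bigAnd s).
Proof.
move=> sI; rewrite /bigAnd big_seq; apply: (big_ind introspective) => //.
  by apply: SigmaH_conseq1 (H_A2 idx1) _ => v /= ->; rewrite andbF.
exact: introspective_And.
Qed.

(** Under [g], which is then certain, [L_r f] gives [L_r (f /\ g)], and [f /\ g]
    implies [h]. *)
Lemma Lop_congr_introspective g f h r :
  introspective g -> SigmaH (Imp g (Iff f h)) ->
  SigmaH (Imp g (Iff (Lop r f) (Lop r h))).
Proof.
move=> gI.
have half f1 f2 : SigmaH (Imp g (Iff f1 f2)) ->
    SigmaH (Imp g (Imp (Lop r f1) (Lop r f2))).
  move=> gf12.
  have mono : SigmaH (Imp (Lop r (And f1 g)) (Lop r f2)).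
    apply: Lop_mono; apply: SigmaH_conseq1 gf12 _ => v /=.
    by case: (peval v g); case: (peval v f1); case: (peval v f2).
  apply: SigmaH_conseq3 gI (Lop_And_certain r f1 g) mono _ => v /=.
  by case: (peval v g); do 4!case: (v _).
move=> gfh.
have ghf : SigmaH (Imp g (Iff h f)).
  apply: SigmaH_conseq1 gfh _ => v /=.
  by case: (peval v g); case: (peval v f); case: (peval v h).
apply: SigmaH_conseq2 (half _ _ gfh) (half _ _ ghf) _ => v /=.
by case: (peval v g); do 2!case: (v _).
Qed.

Definition modal_literal (f : fml) : Prop :=
  exists r chi, f = Lop r chi \/ f = Neg (Lop r chi).

Lemma introspective_literal f : modal_literal f -> introspective f.
Proof. by case=> r [chi [->|->]]; [apply: H_4p | apply: H_5p]. Qed.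

(** * Languages and provable equivalence *)

Lemma clsP f g : cls f = cls g <-> SigmaH (Iff f g).
Proof.
split=> [/eqmodP/asboolP //|fg]; apply/eqmodP; exact/asboolP.
Qed.

Lemma lang_fml_le q d d' w f : (d <= d')%N -> lang_fml q d w f -> lang_fml q d' w f.
Proof. by move=> le_dd' [fw fq /leq_trans]; split=> //; auto. Qed.

Lemma lang_le q d d' w : (d <= d')%N -> lang q d w `<=` lang q d' w.
Proof. by move=> le_dd' _ [f fL <-]; exists f => //; apply: lang_fml_le fL. Qed.

Lemma lang_cls q d w f : lang_fml q d w f -> lang q d w (cls f).
Proof. by exists f. Qed.

Lemma lang_Neg q d w f : lang q d w (cls f) -> lang q d w (cls (Neg f)).
Proof.
case=> f' f'L /clsP ff'; exists (Neg f') => //; apply/clsP.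
apply: SigmaH_conseq1 ff' _ => v /=.
by case: (peval v f); case: (peval v f').
Qed.

Lemma lang_Lop q d w (k : 'I_q.+1) f :
  lang q d w (cls f) -> lang q d.+1 w (cls (Lop (grid k) f)).
Proof.
case=> f' [f'w f'q f'd] /clsP ff'; exists (Lop (grid k) f').
  by split=> //; split=> //; exists k.
exact/clsP/H_DIS.
Qed.

Lemma lang_fml_Top q d w : (0 < w)%N -> lang_fml q d w Top.
Proof. by []. Qed.

Lemma lang_fml_And q d w f g :
  lang_fml q d w f -> lang_fml q d w g -> lang_fml q d w (And f g).
Proof. by move=> [? ? ?] [? ? ?]; split=> //=; rewrite geq_max; apply/andP. Qed.

Lemma lang_fml_bigAnd q d w s : (0 < w)%N ->
  {in s, forall f, lang_fml q d w f} -> lang_fml q d w (bigAnd s).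
Proof.
move=> w0 sL; rewrite /bigAnd big_seq; apply: (big_ind (lang_fml q d w)) => //.
exact: lang_fml_And.
Qed.

Lemma lang_fml_bigOr q d w (I : finType) (P : pred I) (F : I -> fml) :
  (0 < w)%N -> (forall i, P i -> lang_fml q d w (F i)) ->
  lang_fml q d w (\big[Or/Bot]_(i | P i) F i).
Proof.
move=> w0 FL; apply: (big_ind (lang_fml q d w)) => // f g.
exact: (@lang_fml_And q d w (Neg f) (Neg g)).
Qed.

(** * Membership in atoms *)

(** Closure under deduction: adding a consequence to an atom keeps it consistent,
    so by maximality the consequence was there. *)
Lemma atom_deduce q d w Phi s f : OmegaH q d w Phi ->
  {in s, forall g, Phi (cls g)} -> SigmaH (Imp (bigAnd s) f) ->
  lang q d w (cls f) -> Phi (cls f).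
Proof.
move=> [PhiL PhiC PhiM] sPhi sf fL.
suff <- : Phi `|` [set cls f] = Phi by right.
apply: PhiM => [_ [/PhiL //|-> //]|t tPsi tN|]; last exact: subsetUl.
have := PhiC ([seq g <- t | `[< Phi (cls g) >]] ++ s); apply.
  move=> g /=; rewrite mem_cat mem_filter => /orP[/andP[/asboolP] //|].
  exact: sPhi.
set u := _ ++ s.
suff ut : SigmaH (Imp (bigAnd u) (bigAnd t)).
  apply: SigmaH_conseq2 tN ut _ => v /=.
  by case: (peval v (bigAnd u)); case: (peval v (bigAnd t)).
apply: bigAnd_intro => g gt.
case: (tPsi g gt) => [Phig|/clsP gf].
  by apply: bigAnd_elim; rewrite mem_cat mem_filter gt andbT asboolT.
have us : SigmaH (Imp (bigAnd u) (bigAnd s)).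
  by apply: bigAnd_intro => h hs; apply: bigAnd_elim; rewrite mem_cat hs orbT.
apply: SigmaH_conseq2 gf (Imp_trans us sf) _ => v /=.
by case: (peval v (bigAnd u)); case: (peval v g); case: (peval v f).
Qed.

Lemma atom_not_both q d w Phi f : OmegaH q d w Phi ->
  Phi (cls f) -> ~ Phi (cls (Neg f)).
Proof.
move=> [_ PhiC _] Phif PhiNf; apply: (PhiC [:: f; Neg f]).
  by move=> g /=; rewrite !inE => /orP[] /eqP->.
by apply: H_taut => v; rewrite /= peval_bigAnd /= andbT andbN.
Qed.

(** A formula that cannot be added consistently is refuted by finitely many
    members of the atom, so its negation is already there. *)
Lemma atom_decides q d w Phi f : OmegaH q d w Phi -> lang q d w (cls f) ->
  Phi (cls f) \/ Phi (cls (Neg f)).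
Proof.
move=> PhiO fL; case: (pselect (Phi (cls f))) => [|nPhif]; first by left.
right; have [PhiL PhiC PhiM] := PhiO.
have : ~ consistent (cls @^-1` (Phi `|` [set cls f])).
  move=> PsiC; apply: nPhif.
  suff <- : Phi `|` [set cls f] = Phi by right.
  by apply: PhiM => // _ [/PhiL //|-> //].
move=> /existsNP[t] /not_implyP[tPsi] /contrapT tN.
pose s := [seq g <- t | `[< Phi (cls g) >]].
apply: (@atom_deduce _ _ _ _ s _ PhiO) (lang_Neg fL).
  by move=> g; rewrite mem_filter => /andP[/asboolP].
have sft : SigmaH (Imp (And (bigAnd s) f) (bigAnd t)).
  apply: bigAnd_intro => g gt.
  case: (tPsi g gt) => [Phig|/clsP gf].
    have sg : SigmaH (Imp (bigAnd s) g).
      by apply: bigAnd_elim; rewrite mem_filter gt andbT asboolT.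
    apply: SigmaH_conseq1 sg _ => v /=.
    by case: (peval v (bigAnd s)); case: (peval v g); case: (peval v f).
  apply: SigmaH_conseq1 gf _ => v /=.
  by case: (peval v (bigAnd s)); case: (peval v g); case: (peval v f).
apply: SigmaH_conseq2 tN sft _ => v /=.
by case: (peval v (bigAnd s)); case: (peval v (bigAnd t)); case: (peval v f).
Qed.

Lemma atom_Neg q d w Phi f : OmegaH q d w Phi -> lang q d w (cls f) ->
  Phi (cls (Neg f)) <-> ~ Phi (cls f).
Proof.
move=> PhiO fL; split=> [Nf /(atom_not_both PhiO) //|nf].
by case: (atom_decides PhiO fL).
Qed.

Lemma atom_And q d w Phi f g : OmegaH q d w Phi ->
  lang_fml q d w f -> lang_fml q d w g ->
  Phi (cls (And f g)) <-> Phi (cls f) /\ Phi (cls g).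
Proof.
move=> PhiO fL gL; split=> [fg|[Phif Phig]].
  have mem1 : {in [:: And f g], forall h, Phi (cls h)}.
    by move=> h; rewrite inE => /eqP->.
  split; apply: (atom_deduce PhiO mem1); try exact: lang_cls.
    apply: H_taut => v; rewrite /= peval_bigAnd /=.
    by case: (peval v f); case: (peval v g).
  apply: H_taut => v; rewrite /= peval_bigAnd /=.
  by case: (peval v f); case: (peval v g).
apply: (@atom_deduce _ _ _ _ [:: f; g] _ PhiO).
- by move=> h; rewrite !inE => /orP[] /eqP->.
- apply: H_taut => v; rewrite /= peval_bigAnd /=.
  by case: (peval v f); case: (peval v g).
- exact/lang_cls/lang_fml_And.
Qed.

Lemma atom_ext q d d' w Phi Phi' f : (d <= d')%N ->
  OmegaH q d w Phi -> OmegaH q d' w Phi' -> Phi `<=` Phi' ->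
  lang q d w (cls f) -> Phi' (cls f) <-> Phi (cls f).
Proof.
move=> le_dd' PhiO Phi'O sub fL; split=> [Phi'f|/sub //].
case: (atom_decides PhiO fL) => // /sub.
by move/(atom_not_both Phi'O Phi'f).
Qed.

(** The literals in [s] make the equivalence of [f] and [h] certain, and [h] being
    propositional, [L_r h] lies within the depth that the atom [Gam] decides. *)
Lemma atom_ext_Lop q d w Gam Gam' (s : seq fml) f h (k : 'I_q.+1) : (0 < d)%N ->
  OmegaH q d w Gam -> OmegaH q d.+1 w Gam' -> Gam `<=` Gam' ->
  {in s, forall p, modal_literal p /\ Gam (cls p)} ->
  SigmaH (Imp (bigAnd s) (Iff f h)) ->
  lang q d w (cls f) -> lang q 0 w (cls h) ->
  Gam' (cls (Lop (grid k) f)) <-> Gam (cls (Lop (grid k) h)).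
Proof.
move=> d0 GamO Gam'O sub sM sfh fL hL.
have hdL : lang q d w (cls (Lop (grid k) h)) by apply/(lang_le d0)/lang_Lop.
have hd1L : lang q d.+1 w (cls (Lop (grid k) h)) by apply: lang_le hdL.
have fd1L := lang_Lop k fL.
rewrite -(atom_ext _ GamO Gam'O sub hdL) //.
have sI : introspective (bigAnd s).
  by apply: introspective_bigAnd => p /sM[/introspective_literal].
have sLop := Lop_congr_introspective (grid k) sI sfh.
have mem p0 : Gam' (cls p0) -> {in p0 :: s, forall p, Gam' (cls p)}.
  by move=> Gam'p p; rewrite inE => /orP[/eqP->//|/sM[_ /sub]].
split=> [/mem|/mem] memG; apply: (atom_deduce Gam'O memG) => //;
  apply: SigmaH_conseq1 sLop _ => v; rewrite /= !peval_bigAnd /=;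
  by case: (all _ _); do 2!case: (v _).
Qed.

(** * Probability parts of statements *)

Lemma conj_of_elim A g f : conj_of A g -> A f -> SigmaH (Imp g f).
Proof.
move=> [s [_ As ->]] Af; have /As[f' f's /clsP f'f] : (cls @` A) (cls f) by exists f.
apply: SigmaH_conseq2 (bigAnd_elim f's) f'f _ => v /=.
by case: (peval v (bigAnd s)); case: (peval v f); case: (peval v f').
Qed.

Lemma prob_part_elim q d w Phi g f : prob_part q d w Phi g ->
  modal_literal f -> lang_fml q d w f -> Phi (cls f) -> SigmaH (Imp g f).
Proof.
move=> [g1 [g2 [g1P g2P ->]]] [r [chi [-> fL Phif|-> fL Phif]]].
- have g1f : SigmaH (Imp g1 (Lop r chi)).
    by apply: conj_of_elim g1P _; split=> //; exists r, chi.
  apply: SigmaH_conseq1 g1f _ => v /=.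
  by case: (peval v g1); case: (peval v g2); case: (v _).
- have g2f : SigmaH (Imp g2 (Neg (Lop r chi))).
    by apply: conj_of_elim g2P _; split=> //; exists r, chi.
  apply: SigmaH_conseq1 g2f _ => v /=.
  by case: (peval v g1); case: (peval v g2); case: (v _).
Qed.

Lemma prob_part_literals q d w Phi g : prob_part q d w Phi g ->
  exists s : seq fml, {in s, forall f, [/\ modal_literal f, lang_fml q d w f & Phi (cls f)]} /\
            SigmaH (Iff g (bigAnd s)).
Proof.
move=> [_ [_ [[s1 [s1A _ ->]] [s2 [s2A _ ->]] ->]]]; exists (s1 ++ s2); split.
  move=> f; rewrite mem_cat => /orP[/s1A|/s2A] [fL Phif [r [chi fE]]]; split=> //.
    by exists r, chi; left.
  by exists r, chi; right.
apply: H_taut => v; rewrite /= !peval_bigAnd all_cat.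
by case: (all _ s1); case: (all _ s2).
Qed.

(** A probability part that fails to imply [gp] belongs to an atom omitting some
    modal literal of [Phi]; that atom contains the opposite literal. *)
Lemma prob_part_implies_or_excludes q d w Phi Psi gp hp :
  OmegaH q d w Psi -> prob_part q d w Phi gp -> prob_part q d w Psi hp ->
  SigmaH (Imp hp gp) \/ SigmaH (Imp gp (Neg hp)).
Proof.
move=> PsiO gpP hpP; have [s [sP gps]] := prob_part_literals gpP.
case: (pselect {in s, forall f, Psi (cls f)}) => [sPsi|].
  left; have hps : SigmaH (Imp hp (bigAnd s)).
    apply: bigAnd_intro => f fs; have [fM fL _] := sP f fs.
    by apply: prob_part_elim hpP fM fL _; apply: sPsi.
  apply: SigmaH_conseq2 gps hps _ => v /=.
  by case: (peval v gp); case: (peval v hp); case: (peval v (bigAnd s)).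
move=> /existsNP[f] /not_implyP[fs nPsif]; right.
have [fM fL Phif] := sP f fs.
have gpf := prob_part_elim gpP fM fL Phif.
have PsiNf : Psi (cls (Neg f)) by apply/(atom_Neg PsiO (lang_cls fL)).
have hpf : SigmaH (Imp hp (Neg f)).
  case: fM fL PsiNf => r [chi [->|->]] fL PsiNf.
    by apply: prob_part_elim hpP _ _ PsiNf; first by exists r, chi; right.
  (* The opposite of [Neg (Lop r chi)] is [Lop r chi], up to double negation. *)
  have dn : SigmaH (Iff (Neg (Neg (Lop r chi))) (Lop r chi)).
    by apply: H_taut => v /=; case: (v _).
  have hpL : SigmaH (Imp hp (Lop r chi)).
    have LL : lang_fml q d w (Lop r chi) by case: fL.
    apply: prob_part_elim hpP _ LL _; first by exists r, chi; left.
    by move/clsP: dn => <-.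
  apply: SigmaH_conseq1 hpL _ => v /=.
  by case: (peval v hp); case: (v _).
apply: SigmaH_conseq2 gpf hpf _ => v /=.
by case: (peval v gp); case: (peval v hp); case: (peval v f).
Qed.

Lemma prob_part_dichotomy q d w Phi Psi gp hp :
  OmegaH q d w Phi -> OmegaH q d w Psi ->
  prob_part q d w Phi gp -> prob_part q d w Psi hp ->
  cls hp = cls gp \/ SigmaH (Imp gp (Neg hp)).
Proof.
move=> PhiO PsiO gpP hpP.
case: (prob_part_implies_or_excludes PsiO gpP hpP) => [hg|]; last by right.
case: (prob_part_implies_or_excludes PhiO hpP gpP) => [gh|hNg].
  left; apply/clsP; apply: SigmaH_conseq2 hg gh _ => v /=.
  by case: (peval v gp); case: (peval v hp).
right; apply: SigmaH_conseq1 hNg _ => v /=.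
by case: (peval v gp); case: (peval v hp).
Qed.

Lemma lang_fml_prop_part q d w Phi g : (0 < w)%N ->
  prop_part q d w Phi g -> lang_fml q 0 w g.
Proof.
move=> w0 [_ [_ [[s1 [s1A _ ->]] [s2 [s2A _ ->]] ->]]].
apply: lang_fml_And; apply: lang_fml_bigAnd => // f.
  by move=> /s1A[fL _ [i fE]]; rewrite fE in fL *; case: fL.
by move=> /s2A[fL _ [i fE]]; rewrite fE in fL *; case: fL.
Qed.

(** Under [gamp], disjuncts past [m] are false because their probability parts
    contradict [gamp], and the others reduce to their propositional parts. *)
Lemma normal_form_collapse q d w Gam gamp phi n m (phi0 phip : 'I_n -> fml) :
  OmegaH q d w Gam -> prob_part q d w Gam gamp ->
  (forall i : 'I_n, exists2 Phi : set lfml,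
     OmegaH q d w Phi & is_statement q d w Phi (phi0 i) (phip i)) ->
  cls phi = cls (\big[Or/Bot]_(i < n) And (phi0 i) (phip i)) ->
  (forall i : 'I_n, (i < m)%N -> cls (phip i) = cls gamp) ->
  (forall j : 'I_n, (m <= j)%N -> cls (phip j) <> cls gamp) ->
  SigmaH (Imp gamp (Iff phi (\big[Or/Bot]_(i < n | (i < m)%N) phi0 i))).
Proof.
move=> GamO gampP phiS /clsP phiN phipE phipN.
pose side (i : 'I_n) := if (i < m)%N then Iff (phip i) gamp else Imp gamp (Neg (phip i)).
apply: (@SigmaH_conseq
  (Iff phi (\big[Or/Bot]_(i < n) And (phi0 i) (phip i))
     :: [seq side i | i <- index_enum 'I_n])).
  move=> p; rewrite inE => /orP[/eqP-> //|/mapP[i _ ->]]; rewrite /side.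
  case: ltnP => [im|mi]; first exact/clsP/phipE.
  have [Phi PhiO [_ phipP]] := phiS i.
  by case: (prob_part_dichotomy GamO PhiO gampP phipP) => // /(phipN i mi).
move=> v /= /andP[]; rewrite !peval_bigOr all_map => + /allP sidev.
case gampv : (peval v gamp) => //=.
set a := has _ _; set b := has _ _.
suff -> : a = b by case: (peval v phi); case: b.
apply: eq_in_has => i /sidev /=; rewrite /side.
by case: ifP => _ /=; rewrite gampv;
  case: (peval v (phi0 i)); case: (peval v (phip i)).
Qed.

(** * Propositional form of a formula relative to an atom *)

(** Outermost modal subformulas of [f] become [Top] or [Bot]; recording in [s] only
    those that occur keeps [s] finite without any bound on the language. *)
Lemma atom_flatten q d w Gam f : (0 < w)%N -> OmegaH q d w Gam ->
  lang_fml q d w f ->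
  exists (s : seq fml) h, [/\ {in s, forall p, modal_literal p /\ Gam (cls p)},
    lang_fml q 0 w h & SigmaH (Imp (bigAnd s) (Iff f h))].
Proof.
move=> w0 GamO; elim: f => [i|f IHf|f IHf g IHg|r f _] fL.
- exists [::], (Var i); split; [by [] | by case: fL |].
  by apply: H_taut => v; rewrite /= peval_bigAnd /=; case: (v _).
- have [s [h [sM hL sfh]]] := IHf fL; exists s, (Neg h); split=> //.
  apply: SigmaH_conseq1 sfh _ => v /=.
  by case: (peval v (bigAnd s)); case: (peval v f); case: (peval v h).
- have [[fw gw] [fq gq] /=] := fL; rewrite geq_max => /andP[fd gd].
  have [s [h [sM hL sfh]]] := IHf (And3 fw fq fd).
  have [t [k [tM kL tgk]]] := IHg (And3 gw gq gd).
  exists (s ++ t), (And h k); split; last 1 first.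
  + apply: SigmaH_conseq2 sfh tgk _ => v; rewrite /= !peval_bigAnd all_cat.
    case: (all _ s); case: (all _ t) => //=.
    by case: (peval v f); case: (peval v g); case: (peval v h); case: (peval v k).
  + by move=> p; rewrite mem_cat => /orP[/sM|/tM].
  + exact: lang_fml_And.
- case: (atom_decides GamO (lang_cls fL)) => Gamf.
  + exists [:: Lop r f], Top; split=> [p||]; last 2 first.
    * exact: lang_fml_Top.
    * by apply: H_taut => v; rewrite /= peval_bigAnd /= andbN; case: (v _).
    by rewrite inE => /eqP->; split=> //; exists r, f; left.
  + exists [:: Neg (Lop r f)], Bot; split=> [p||]; last 2 first.
    * exact: lang_fml_Top.
    * by apply: H_taut => v; rewrite /= peval_bigAnd /= andbN; case: (v _).
    by rewrite inE => /eqP->; split=> //; exists r, f; right.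
Qed.

(** * Uniqueness of the extension *)

Lemma atom_ext_unique q d w Gam Delta1 Delta2 : (0 < d)%N -> (0 < w)%N ->
  OmegaH q d w Gam -> OmegaH q d.+1 w Delta1 -> OmegaH q d.+1 w Delta2 ->
  Gam `<=` Delta1 -> Gam `<=` Delta2 -> Delta1 = Delta2.
Proof.
move=> d0 w0 GamO D1O D2O sub1 sub2.
have agree f : lang_fml q d.+1 w f -> Delta1 (cls f) <-> Delta2 (cls f).
  elim: f => [i|f IHf|f IHf g IHg|r f _] fL.
  - have iL : lang q d w (cls (Var i)) by apply: lang_cls; case: fL.
    by rewrite (atom_ext (leqnSn d) GamO D1O sub1 iL)
               (atom_ext (leqnSn d) GamO D2O sub2 iL).
  - have fL' : lang q d.+1 w (cls f) by exact: lang_cls.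
    by rewrite (atom_Neg D1O fL') (atom_Neg D2O fL') IHf.
  - have [[fw gw] [fq gq] /=] := fL; rewrite geq_max => /andP[fd gd].
    have fL' := And3 fw fq fd; have gL' := And3 gw gq gd.
    by rewrite (atom_And D1O fL' gL') (atom_And D2O fL' gL') IHf // IHg.
  - have [fw [[k ->] fq] fd] := fL.
    have fL' : lang_fml q d w f by split.
    have [s [h [sM hL sfh]]] := atom_flatten w0 GamO fL'.
    by rewrite (atom_ext_Lop k d0 GamO D1O sub1 sM sfh (lang_cls fL') (lang_cls hL))
               (atom_ext_Lop k d0 GamO D2O sub2 sM sfh (lang_cls fL') (lang_cls hL)).
have [L1 _ _] := D1O; have [L2 _ _] := D2O.
apply/seteqP; split=> [x xD|x xD].
  by have [f fL fx] := L1 x xD; rewrite -fx in xD *; apply/agree.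
by have [f fL fx] := L2 x xD; rewrite -fx in xD *; apply/agree.
Qed.

(** * The extension theorem *)

(** [M_r] is [L_{1-r}] of a negation, and the grid is symmetric under [1 - r]; so
    beta is read off the grid indices of [L] as well. *)
Lemma onem_grid q (k : 'I_q.+1) : (0 < q)%N -> onem_idx (grid k) = grid (rev_ord k).
Proof.
move=> q0; apply: val_inj; rewrite /= subSS natrB -1?ltnS // mulrBl divff //.
by rewrite pnatr_eq0 -lt0n.
Qed.

Theorem theorem3p17 (q d w : nat) (hq : (1 <= q)%N) (hd : (1 <= d)%N)
    (hw : (1 <= w)%N) (Gam Gam' : set lfml)
    (hGam : OmegaH q d w Gam) (hGam' : OmegaH q d.+1 w Gam')
    (hext : Gam `<=` Gam') :
  (forall (gam0 gamp phi : fml) (n m : nat) (phi0 phip : 'I_n -> fml),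
     is_statement q d w Gam gam0 gamp ->
     lang q d w (cls phi) ->
     (forall i : 'I_n, exists2 Phi : set lfml,
        OmegaH q d w Phi & is_statement q d w Phi (phi0 i) (phip i)) ->
     cls phi = cls (\big[Or/Bot]_(i < n) And (phi0 i) (phip i)) ->
     (m <= n)%N ->
     (forall i : 'I_n, (i < m)%N -> cls (phip i) = cls gamp) ->
     (forall j : 'I_n, (m <= j)%N -> cls (phip j) <> cls gamp) ->
     alpha q Gam' phi
       = alpha q (Gam `&` lang q 1 w) (\big[Or/Bot]_(i < n | (i < m)%N) phi0 i)
     /\ beta q Gam' phi
       = beta q (Gam `&` lang q 1 w) (\big[Or/Bot]_(i < n | (i < m)%N) phi0 i))
  /\ unique (fun Delta : set lfml => OmegaH q d.+1 w Delta /\ Gam `<=` Delta) Gam'.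
Proof.
split; last first.
  by split=> // Delta [DO sub]; apply: (atom_ext_unique hd hw hGam).
move=> gam0 gamp phi n m phi0 phip [_ gampP] phiL phiS phiN _ phipE phipN.
have gphi := normal_form_collapse hGam gampP phiS phiN phipE phipN.
set psi := \big[Or/Bot]_(i < n | (i < m)%N) phi0 i in gphi *.
have psiL : lang q 0 w (cls psi).
  apply: lang_cls; apply: lang_fml_bigOr => // i _.
  by have [Phi _ [phi0P _]] := phiS i; apply: lang_fml_prop_part phi0P.
have [s [sP gs]] := prob_part_literals gampP.
have sM : {in s, forall p, modal_literal p /\ Gam (cls p)} by move=> p /sP[].
have sphi : SigmaH (Imp (bigAnd s) (Iff phi psi)).
  apply: SigmaH_conseq2 gs gphi _ => v /=.
  by case: (peval v gamp); case: (peval v (bigAnd s)).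
have sNphi : SigmaH (Imp (bigAnd s) (Iff (Neg phi) (Neg psi))).
  apply: SigmaH_conseq1 sphi _ => v /=.
  by case: (peval v (bigAnd s)); case: (peval v phi); case: (peval v psi).
have same f h (k : 'I_q.+1) : SigmaH (Imp (bigAnd s) (Iff f h)) ->
    lang q d w (cls f) -> lang q 0 w (cls h) ->
    Gam' (cls (Lop (grid k) f)) <-> (Gam `&` lang q 1 w) (cls (Lop (grid k) h)).
  move=> sfh fL hL.
  rewrite (atom_ext_Lop k hd hGam hGam' hext sM sfh fL hL).
  by split=> [|[]//]; split=> //; apply: lang_Lop.
split.
- rewrite /alpha; congr (val (grid (arg_max _ _ _))).
  by apply/funext => k; apply: asbool_equiv_eq; apply: same.
- rewrite /beta; congr (val (grid (arg_min _ _ _))).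
  apply/funext => k; apply: asbool_equiv_eq; rewrite /Mop onem_grid //.
  by apply: same => //; apply: lang_Neg.
Qed.
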